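(* Let $A\in\mathbb{C}^{n\times n}$ be a Hermitian matrix with spectrum $\{\lambda_i\}_{i=1}^n$, and let $\widetilde{A}=A+E$ with spectrum $\{\widetilde{\lambda}_i\}_{i=1}^n$, where $E\in\mathbb{C}^{n\times n}$ is an arbitrary perturbation. Let $\widetilde{U}\in\mathscr{U}_n(\widetilde{A})$ and $\Delta=\mathcal{U}(\widetilde{U}^{\ast}\widetilde{A}\widetilde{U})$. Then there is a permutation $\pi$ of $\{1,\ldots,n\}$ such that, with $\mathbb{D}_2=\big(\sum_{i=1}^{n}|\widetilde{\lambda}_{\pi(i)}-\lambda_i|^2\big)^{1/2}$, all of the following hold: \begin{align*} \mathbb{D}_{2}&\leq\sqrt{\|E\|_{F}^{2}+\delta(E)^{2}},\\ \mathbb{D}_{2}&\leq\sqrt{\|E\|_{F}^{2}+\sqrt{2}\,\delta(E)\|\Delta\|_{F}},\\ \mathbb{D}_{2}&\leq\sqrt{\|E\|_{F}^{2}+2\delta(E)\|\Delta\|_{F}-\|\Delta\|_{F}^{2}},\\ \mathbb{D}_{2}&\leq\sqrt{\|E\|_{F}^{2}+\tfrac{1}{2}\delta(A)^{2}},\\ \mathbb{D}_{2}&\leq\sqrt{\|E\|_{F}^{2}+\sqrt{2}\,\delta(A)\|\Delta\|_{F}-\|\Delta\|_{F}^{2}}. \end{align*}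
   Context: Spectra are listed with algebraic multiplicity. $\|\cdot\|_F$ is the Frobenius norm, $X^{\ast}$ is the conjugate transpose, and $\mathrm{tr}$ is the trace. For $M\in\mathbb{C}^{n\times n}$, $\mathcal{U}(M)$ denotes the strictly upper triangular part of $M$ (entries with $i<j$ kept, all others set to $0$), $\delta(M):=\big(\|M\|_F^2-\frac1n|\mathrm{tr}(M)|^2\big)^{1/2}$ (the quantity in parentheses is always nonnegative), and $\mathscr{U}_n(M)$ denotes the set of all $n\times n$ unitary matrices $U$ such that $U^{\ast}MU$ is upper triangular. *)

(* Defs.v *)
From HB Require Import structures.
From mathcomp Require Import all_boot all_order all_fingroup all_algebra.
From mathcomp Require Export complex reals.

Set Implicit Arguments.
Unset Strict Implicit.
Unset Printing Implicit Defensive.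

Import Order.TTheory GRing.Theory Num.Theory.
Local Open Scope ring_scope.
Local Open Scope sesquilinear_scope.

(* Norms and square roots below are elements of the field C itself, where      *)
(* x <= y means that y - x is a nonnegative real. For a negative real x,       *)
(* sqrtC x is purely imaginary and nonzero, so 0 <= y <= sqrtC x cannot hold:  *)
(* a bound by sqrtC x includes the claim that 0 <= x.                          *)

Definition is_spectrum (C : numClosedFieldType) (n : nat) (M : 'M[C]_n)
    (l : 'I_n -> C) : Prop :=
  char_poly M = \prod_(i < n) ('X - (l i)%:P).

Definition frob (C : numClosedFieldType) (m n : nat) (M : 'M[C]_(m, n)) : C :=
  sqrtC (\sum_i \sum_j `|M i j| ^+ 2).

Definition delta (C : numClosedFieldType) (n : nat) (M : 'M[C]_n) : C :=
  sqrtC (frob M ^+ 2 - n%:R^-1 * `|\tr M| ^+ 2).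

Definition strict_upper (C : numClosedFieldType) (n : nat) (M : 'M[C]_n) :
    'M[C]_n :=
  \matrix_(i, j) if (i < j)%N then M i j else 0.

(* is_trig_mx means lower triangular, hence the transpose. *)
Definition schur_unitary (C : numClosedFieldType) (n : nat) (M : 'M[C]_n) :
    pred 'M[C]_n :=
  [pred U | (U \is unitarymx) && is_trig_mx (U^t* *m M *m U)^T].

(* Main.v *)
Require Import Defs.
From HB Require Import structures.
From mathcomp Require Import all_boot all_order all_fingroup all_algebra.
From mathcomp Require Import complex reals.
From mathcomp Require Import ring.

Set Implicit Arguments.
Unset Strict Implicit.
Unset Printing Implicit Defensive.

Import Order.TTheory GRing.Theory Num.Theory.
Local Open Scope ring_scope.
Local Open Scope sesquilinear_scope.

(** Conjugating by [U], put [H = U^* A U] (still Hermitian), [T = U^* (A + E) U]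
    (upper triangular, with strict upper part [Delta]) and [F = T - H], which is
    unitarily similar to [E].  Let [D] be the diagonal of [T] and [S] the strict
    upper part of [H].  [D] is normal and carries the spectrum of [A + E], so the
    Hoffman-Wielandt inequality for [D] and [H] gives one permutation with
    [D2^2 <= |D - H|^2].  Off the diagonal, [D - H] differs from [F] only in its
    upper part, [- S] instead of [Delta - S], hence ([frob_diag_sub])
      [D2^2 <= |E|^2 + a^2 - b^2],   [a = |S|], [b = |Delta - S|].
    All five bounds estimate [a^2 - b^2] for this one permutation.  Since the
    lower part of [F] is [- S^*], the off-diagonal mass of [F] is [a^2 + b^2] and
    that of [H] is [2 a^2]; the off-diagonal mass of a matrix is at most the
    square of its [delta] ([offdiag_le_delta]), and [delta] is invariant under
    unitary similarity, so
      [a^2 + b^2 <= delta(E)^2]  and  [2 a^2 <= delta(A)^2].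
    The first and fourth bounds drop [- b^2].  With [d = |Delta|], the second one
    factors [a^2 - b^2 = (a - b) (a + b)], where [a - b <= d] by the triangle
    inequality and [a + b <= sqrt 2 delta(E)]; the third and fifth use
    [b >= |d - a|], i.e. [a^2 - b^2 <= 2 a d - d^2].

    In Hoffman-Wielandt, diagonalizing [H] by a unitary [P] writes [|D - H|^2] as
    an average of the costs [|mu_i - lam_j|^2] with the doubly stochastic weights
    [|P_ji|^2].  As the [lam_j] are real, these costs are, up to terms depending
    on [i] alone or [j] alone, [- 2 Re(mu_i) lam_j], and matching both families
    in increasing order is optimal.  Optimality is certified by dual potentials
    ([optimal_matching]), which bound the average directly, without decomposing
    the weights into permutation matrices. *)

(** * Optimal matching of real families *)

(** [v] is a discrete integral of [x] against [y]: for increasing [x], each step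
    [x k * (y k.+1 - y k)] between [i] and [j] compares with the same step taken
    at the constant slope [x i], whichever of [i] and [j] is the larger. *)
Lemma monotone_potential (R : numDomainType) (x y : nat -> R) :
    {homo x : i j / (i <= j)%N >-> i <= j} ->
    {homo y : i j / (i <= j)%N >-> i <= j} ->
  exists v : nat -> R, forall i j, x i * (y j - y i) <= v j - v i.
Proof.
move=> x_mono y_mono.
exists (fun j => \sum_(0 <= k < j) x k * (y k.+1 - y k)) => i j.
have y_incr k : 0 <= y k.+1 - y k by rewrite subr_ge0 y_mono.
case: (leqP i j) => [le_ij | /ltnW le_ji].
- rewrite (big_cat_nat _ le_ij) //= addrAC subrr add0r -telescope_sumr //.
  rewrite mulr_sumr; apply: ler_sum_nat => k /andP[le_ik _].
  by rewrite ler_wpM2r // x_mono.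
rewrite (big_cat_nat _ le_ji) //= opprD addNKr -[y j - y i]opprB mulrN lerN2.
rewrite -telescope_sumr // mulr_sumr; apply: ler_sum_nat => k /andP[_ lt_ki].
by rewrite ler_wpM2r // x_mono // ltnW.
Qed.

Lemma perm_eq_ord (T : eqType) n (x y : 'I_n -> T) :
    perm_eq [seq x i | i <- enum 'I_n] [seq y i | i <- enum 'I_n] ->
  exists p : 'S_n, forall i, x i = y (p i).
Proof.
have mapE (z : 'I_n -> T) : map z (enum 'I_n) = [tuple z i | i < n] by [].
rewrite !mapE => /tuple_permP[p /val_inj xyp].
by exists p => i; have := congr1 (fun t => tnth t i) xyp; rewrite !tnth_mktuple.
Qed.

(** The order of [R] need not be total, so the sorting is justified on the real
    elements only. *)
Lemma sort_real (R : numDomainType) n (x : 'I_n -> R) :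
    (forall i, x i \is Num.real) ->
  exists p : 'S_n, {homo x \o p : i j / (i <= j)%N >-> i <= j}.
Proof.
move=> x_real; set s := [seq x i | i <- enum 'I_n].
have s_sorted : sorted <=%R (sort <=%R s).
  apply: (@sort_sorted_in _ (mem Num.real)); first by move=> a b; apply: real_leVge.
  by rewrite /s all_map; apply/allP=> i _; apply: x_real.
have size_s : size (sort <=%R s) = n.
  by rewrite size_sort size_map size_enum_ord.
have [|p xp] := @perm_eq_ord _ n (fun i => nth 0 (sort <=%R s) i) x.
  rewrite (_ : map _ _ = sort <=%R s) ?perm_sort //.
  apply: (@eq_from_nth _ 0); rewrite size_map size_enum_ord // => i lt_in.
  by rewrite (nth_map (Ordinal lt_in)) ?size_enum_ord // nth_enum_ord.
exists p => i j le_ij /=; rewrite -!xp.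
by apply: (sorted_leq_nth le_trans le_refl); rewrite ?inE ?size_s.
Qed.

(** Finite families reduce to sequences by making them constant past their last
    index, which keeps them monotone. *)
Lemma ord_monotone_potential (R : numDomainType) n (x y : 'I_n -> R) :
    {homo x : i j / (i <= j)%N >-> i <= j} ->
    {homo y : i j / (i <= j)%N >-> i <= j} ->
  exists v : 'I_n -> R, forall i j, x i * (y j - y i) <= v j - v i.
Proof.
case: n x y => [|n] x y x_mono y_mono; first by exists x => -[].
pose c k : 'I_n.+1 := inord (minn k n).
have c_mono i j : (i <= j)%N -> (c i <= c j)%N.
  move=> le_ij; rewrite !inordK ?ltnS ?geq_minr // leq_min geq_minr andbT.
  exact: leq_trans (geq_minl _ _) le_ij.
have cK (i : 'I_n.+1) : c i = i by rewrite /c (minn_idPl (leq_ord i)) inord_val.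
have [|| v vP] := @monotone_potential _ (x \o c) (y \o c).
- by move=> i j /c_mono/x_mono.
- by move=> i j /c_mono/y_mono.
by exists v => i j; have := vP i j; rewrite /= !cK.
Qed.

Lemma normC2_sub_real (C : numClosedFieldType) (z r : C) : r \is Num.real ->
  `|z - r| ^+ 2 = `|z| ^+ 2 + r ^+ 2 - 2 * ('Re z * r).
Proof.
move=> r_real; rewrite !normC2_Re_Im !raddfB /=.
by rewrite (Creal_ReP _ r_real) (Creal_ImP _ r_real); ring.
Qed.

(** [u], [v] are a feasible solution of the linear program dual to the assignment
    problem with costs [`|mu i - x j| ^+ 2], tight along [s]; together they
    certify that [s], which matches the real parts of [mu] with [x] in increasing
    order, is optimal even among fractional matchings. *)
Lemma optimal_matching (C : numClosedFieldType) n (mu x : 'I_n -> C) :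
    (forall i, x i \is Num.real) ->
  exists (s : 'S_n) (u v : 'I_n -> C),
    (forall i j, u i + v j <= `|mu i - x j| ^+ 2) /\
    (forall i, `|mu (s i) - x i| ^+ 2 = u (s i) + v i).
Proof.
move=> x_real.
have [p xp] := sort_real x_real.
have [q muq] := @sort_real _ _ (fun i => 'Re (mu i)) (fun i => Creal_Re _).
have [f fP] := ord_monotone_potential muq xp.
pose a i := (q^-1)%g i; pose b i := (p^-1)%g i.
exists (p^-1 * q)%g, 
 (fun i => `|mu i| ^+ 2 - 2 * ('Re (mu i) * x (p (a i)) - f (a i))),
 (fun j => x j ^+ 2 - 2 * f (b j)); split=> [i j | i].
  have := fP (a i) (b j); rewrite /= /a /b !permKV normC2_sub_real //.
  rewrite -[_ <= `|_| ^+ 2 + _ - _]subr_ge0 -[_ <= f _ - _]subr_ge0.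
  set e := (X in 0 <= X -> _) => e_ge0.
  rewrite [X in 0 <= X](_ : _ = 2 * e) ?mulr_ge0 // /e; ring.
by rewrite normC2_sub_real // permM /a /b permK permKV; ring.
Qed.

(** Weak duality: both marginals of [w] are uniform, so the [w]-average of
    [u i + v j] is the total of the potentials, which is the cost of [s]. *)
Lemma doubly_stochastic_matching (C : numClosedFieldType) n
    (w : 'I_n -> 'I_n -> C) (mu x : 'I_n -> C) :
    (forall i j, 0 <= w i j) ->
    (forall i, \sum_j w i j = 1) -> (forall j, \sum_i w i j = 1) ->
    (forall i, x i \is Num.real) ->
  exists s : 'S_n, \sum_i `|mu (s i) - x i| ^+ 2 <=
                   \sum_i \sum_j w i j * `|mu i - x j| ^+ 2.
Proof.
move=> w_ge0 w_row w_col x_real.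
have [s [u [v [uv_le uv_eq]]]] := optimal_matching mu x_real.
exists s; rewrite (eq_bigr _ (fun i _ => uv_eq i)) big_split /=.
rewrite -(reindex_inj (@perm_inj _ s) (P := predT) (F := u)) /=.
have -> : \sum_i u i + \sum_i v i = \sum_i \sum_j w i j * (u i + v j).
  under [RHS]eq_bigr => i _.
    under eq_bigr => j _ do rewrite mulrDr.
    rewrite big_split /= -mulr_suml w_row mul1r; over.
  rewrite big_split /= exchange_big /=; congr (_ + _).
  by apply: eq_bigr => j _; rewrite -mulr_suml w_col mul1r.
by apply: ler_sum => i _; apply: ler_sum => j _; rewrite ler_wpM2l.
Qed.

(** * Frobenius norm and departure from scalar matrices *)

Section Matrices.
Variable C : numClosedFieldType.

Lemma frobE m n (M : 'M[C]_(m, n)) :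
  frob M ^+ 2 = \sum_i \sum_j `|M i j| ^+ 2.
Proof. exact: sqrtCK. Qed.

Lemma deltaE n (M : 'M[C]_n) :
  delta M ^+ 2 = frob M ^+ 2 - n%:R^-1 * `|\tr M| ^+ 2.
Proof. exact: sqrtCK. Qed.

Lemma frob_ge0 m n (M : 'M[C]_(m, n)) : 0 <= frob M.
Proof.
rewrite sqrtC_ge0 sumr_ge0 // => i _; rewrite sumr_ge0 // => j _.
by rewrite exprn_ge0.
Qed.

Lemma frob_mxtrace m n (M : 'M[C]_(m, n)) : frob M ^+ 2 = \tr (M *m M^t*).
Proof.
rewrite frobE; apply: eq_bigr => i _; rewrite mxE; apply: eq_bigr => j _.
by rewrite !mxE normCK.
Qed.

Lemma frob_dotmx m n (M : 'M[C]_(m, n)) :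
  frob M = sqrtC (dotmx (mxvec M) (mxvec M)).
Proof.
congr sqrtC; rewrite dotmxE mxE pair_big /=.
rewrite (reindex _ (curry_mxvec_bij m n)); apply: eq_bigr => -[i j] _ /=.
by rewrite !mxE !mxvecE normCK.
Qed.

Lemma ler_frobD m n (M N : 'M[C]_(m, n)) : frob (M + N) <= frob M + frob N.
Proof.
rewrite !frob_dotmx linearD /=.
by have [] := triangle_lerif (@dotmx C _) (mxvec M) (mxvec N).
Qed.

Lemma frob_mulmxU m n (M : 'M[C]_(m, n)) (V : 'M_n) :
  V \is unitarymx -> frob (M *m V) ^+ 2 = frob M ^+ 2.
Proof.
by move=> VU; rewrite !frob_mxtrace trmx_mul map_mxM mulmxA mulmxtVK.
Qed.

Lemma frob_Umulmx m n (M : 'M[C]_(m, n)) (V : 'M_m) :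
  V \is unitarymx -> frob (V^t* *m M) ^+ 2 = frob M ^+ 2.
Proof.
move=> VU; rewrite !frob_mxtrace trmx_mul map_mxM mxtrace_mulC trmxCK.
by rewrite mulmxA mulmxtVK // mxtrace_mulC.
Qed.

(** The difference of the two sides is the sum of the squared distances of the
    [z i] to their mean [m]. *)
Lemma normr_sum_sqr n (z : 'I_n -> C) : (0 < n)%N ->
  n%:R^-1 * `|\sum_i z i| ^+ 2 <= \sum_i `|z i| ^+ 2.
Proof.
move=> n_gt0; set t := \sum_i z i; pose m := t / n%:R.
have n_neq0 : n%:R != 0 :> C by rewrite pnatr_eq0 -lt0n.
have t_nm : t = n%:R * m by rewrite mulrC divfK.
suff var : \sum_i `|z i - m| ^+ 2 = \sum_i `|z i| ^+ 2 - n%:R^-1 * `|t| ^+ 2.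
  by rewrite -subr_ge0 -var sumr_ge0 // => i _; rewrite exprn_ge0.
have -> : \sum_i `|z i - m| ^+ 2 =
    \sum_i (`|z i| ^+ 2 - z i * m^* - m * (z i)^* + m * m^*).
  by apply: eq_bigr => i _; rewrite !normCK rmorphB; ring.
rewrite !big_split /= !sumrN -mulr_suml -mulr_sumr -rmorph_sum -/t sumr_const.
rewrite card_ord normCK t_nm rmorphM rmorph_nat -mulr_natl; field.
exact: n_neq0.
Qed.

Lemma delta_ge0 n (M : 'M[C]_n) : (0 < n)%N -> 0 <= delta M.
Proof.
move=> n_gt0; rewrite sqrtC_ge0 subr_ge0 frobE.
apply: le_trans (normr_sum_sqr _ n_gt0) _; apply: ler_sum => i _.
by rewrite (bigD1 i) //= lerDl sumr_ge0 // => j _; rewrite exprn_ge0.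
Qed.

Lemma frob_split n (M : 'M[C]_n) :
  frob M ^+ 2 = \sum_i `|M i i| ^+ 2 + frob (strict_upper M) ^+ 2 +
                frob (strict_upper M^T) ^+ 2.
Proof.
rewrite !frobE [X in _ + X]exchange_big -!big_split; apply: eq_bigr => i _ /=.
rewrite (bigD1 i) //= -addrA; congr (_ + _).
rewrite -big_split [RHS](bigD1 i) //= !mxE ltnn normr0 expr0n addr0 add0r.
apply: eq_bigr => j; rewrite -val_eqE /= !mxE.
by case: ltngtP => //= _ _; rewrite normr0 expr0n ?addr0 ?add0r.
Qed.

(** [delta M ^+ 2] is the off-diagonal mass of [M] plus the spread of its diagonal
    around its mean, a nonnegative quantity by [normr_sum_sqr]. *)
Lemma offdiag_le_delta n (M : 'M[C]_n) : (0 < n)%N ->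
  frob (strict_upper M) ^+ 2 + frob (strict_upper M^T) ^+ 2 <= delta M ^+ 2.
Proof.
move=> n_gt0; rewrite deltaE (frob_split M) -[X in X - _]addrA addrAC lerDr.
by rewrite subr_ge0 normr_sum_sqr.
Qed.

Lemma delta_conj n (M U : 'M[C]_n) : U \is unitarymx ->
  delta (U^t* *m M *m U) = delta M.
Proof.
move=> UU; rewrite /delta frob_mulmxU // frob_Umulmx // mxtrace_mulC mulmxA.
by rewrite (unitarymxP UU) mul1mx.
Qed.

(** * Spectra and the Hoffman-Wielandt inequality *)

Lemma char_poly_conj n (M U : 'M[C]_n) : U \is unitarymx ->
  char_poly (U^t* *m M *m U) = char_poly M.
Proof.
move=> UU; have UV := unitarymxP UU; have VU := mulmx1C UV.
pose P := map_mx polyC U; pose Q := map_mx polyC (U^t*).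
have QP : Q *m P = 1%:M by rewrite -map_mxM VU map_mx1.
rewrite /char_poly (_ : char_poly_mx _ = Q *m char_poly_mx M *m P).
  rewrite !det_mulmx mulrAC -det_mulmx QP det1 mul1r //.
rewrite /char_poly_mx mulmxBr mulmxBl !map_mxM -/P -/Q.
by rewrite scalar_mxC -[_ *m Q *m P]mulmxA QP mulmx1.
Qed.

Lemma spectrum_perm n (M : 'M[C]_n) (l m : 'I_n -> C) :
  is_spectrum M l -> is_spectrum M m -> exists p : 'S_n, forall i, l i = m (p i).
Proof.
rewrite /is_spectrum => -> lm; apply/perm_eq_ord/prod_XsubC_eq.
by rewrite !big_map -enumT !big_enum.
Qed.

(** Multiplying by the unitary [P^*] turns [diag mu - H] into the matrix with
    entries [(mu i - d j) * (P j i)^*], so its squared norm is an average of the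
    [`|mu i - d j| ^+ 2] with the doubly stochastic weights [`|P j i| ^+ 2]. *)
Lemma hoffman_wielandt n (H : 'M[C]_n) (lam mu : 'I_n -> C) :
    H \is hermsymmx -> is_spectrum H lam ->
  exists s : 'S_n, \sum_i `|mu (s i) - lam i| ^+ 2 <=
                   frob (diag_mx (\row_i mu i) - H) ^+ 2.
Proof.
move=> H_herm H_lam; pose P := spectralmx H; pose d := spectral_diag H.
have PU : P \is unitarymx := spectral_unitarymx H.
have /orthomx_spectralP := hermitian_normalmx H_herm.
rewrite -/P -/d invmx_unitary // => H_PdP.
have H_d : is_spectrum H (fun i => d 0 i).
  rewrite /is_spectrum H_PdP char_poly_conj // char_poly_trig ?diag_mx_is_trig //.
  by apply: eq_bigr => i _; rewrite mxE eqxx mulr1n.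
have [p lam_d] := spectrum_perm H_lam H_d.
have d_real i : d 0 i \is Num.real.
  exact: (mxOverP (hermitian_spectral_diag_real H_herm)).
pose w i j := `|P j i| ^+ 2.
have [|||| s sP] := @doubly_stochastic_matching C n w mu (fun i => d 0 i).
- by move=> i j; rewrite exprn_ge0.
- move=> i; have /matrixP/(_ i i) := mulmx1C (unitarymxP PU).
  rewrite !mxE eqxx mulr1n => <-; apply: eq_bigr => j _.
  by rewrite !mxE -normCKC.
- move=> j; have /matrixP/(_ j j) := unitarymxP PU.
  rewrite !mxE eqxx mulr1n => <-; apply: eq_bigr => i _.
  by rewrite !mxE -normCK.
- exact: d_real.
exists (p * s)%g.
rewrite (eq_bigr (fun i => `|mu (s (p i)) - d 0 (p i)| ^+ 2)); last first.
  by move=> i _; rewrite permM lam_d.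
rewrite -(reindex_inj (@perm_inj _ p) (P := predT)
            (F := fun i => `|mu (s i) - d 0 i| ^+ 2)) /=.
apply: le_trans sP _; rewrite le_eqVlt; apply/orP; left; apply/eqP.
rewrite -(frob_mulmxU _ (V := P^t*)) ?trmxC_unitary // mulmxBl.
rewrite H_PdP mulmxtVK // frobE; apply: eq_bigr => i _; apply: eq_bigr => j _.
rewrite mul_diag_mx mul_mx_diag !mxE [_^* * _]mulrC -mulrBl normrM norm_conjC.
by rewrite exprMn mulrC.
Qed.


(** * Triangular and Hermitian parts *)

Lemma strict_upperD n : {morph @strict_upper C n : M N / M + N}.
Proof.
by move=> M N; apply/matrixP=> i j; rewrite !mxE; case: ifP; rewrite ?addr0.
Qed.

Lemma strict_upperN n : {morph @strict_upper C n : M / - M}.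
Proof.
by move=> M; apply/matrixP=> i j; rewrite !mxE; case: ifP; rewrite ?oppr0.
Qed.

Lemma frobN m n (M : 'M[C]_(m, n)) : frob (- M) = frob M.
Proof.
congr sqrtC; apply: eq_bigr => i _; apply: eq_bigr => j _.
by rewrite !mxE normrN.
Qed.

Lemma strict_upper_diag n (d : 'rV[C]_n) : strict_upper (diag_mx d) = 0.
Proof.
apply/matrixP=> i j; rewrite !mxE -val_eqE /=.
by case: ltngtP => // _; rewrite mulr0n.
Qed.

(** The two differences have the same diagonal and, as [T] vanishes below it, the
    same lower part; only their strict upper parts contribute. *)
Lemma frob_diag_sub n (T H : 'M[C]_n) : is_trig_mx T^T ->
  frob (diag_mx (\row_i T i i) - H) ^+ 2 =
  frob (T - H) ^+ 2 + frob (strict_upper H) ^+ 2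
    - frob (strict_upper T - strict_upper H) ^+ 2.
Proof.
move=> /is_trig_mxP T_upper.
have T_low : strict_upper T^T = 0.
  by apply/matrixP=> i j; rewrite mxE [RHS]mxE; case: ifP => // /T_upper.
rewrite (frob_split (_ - H)) (frob_split (T - H)) !linearB /= tr_diag_mx.
rewrite !strict_upperD !strict_upperN strict_upper_diag T_low !sub0r !frobN.
rewrite (eq_bigr (fun i => `|(T - H) i i| ^+ 2)); first by ring.
by move=> i _; rewrite !mxE eqxx mulr1n.
Qed.

Lemma hermsymmx_conj n (H U : 'M[C]_n) :
  H \is hermsymmx -> U^t* *m H *m U \is hermsymmx.
Proof.
move=> /is_hermitianmxP; rewrite expr0 scale1r => H_tC.
apply/is_hermitianmxP; rewrite expr0 scale1r.
by rewrite !trmx_mul !map_mxM trmxCK mulmxA -H_tC.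
Qed.

Lemma frob_lower_herm n (H : 'M[C]_n) : H \is hermsymmx ->
  frob (strict_upper H^T) = frob (strict_upper H).
Proof.
move=> /is_hermitianmxP; rewrite expr0 scale1r => H_tC.
congr sqrtC; apply: eq_bigr => i _; apply: eq_bigr => j _.
rewrite !mxE; case: ifP => // _; rewrite [in RHS]H_tC !mxE.
by rewrite norm_conjC.
Qed.

(** * Estimates of a difference of squares *)

(** Factor the left side; [a + b <= sqrtC 2 * e] because
    [(a + b) ^+ 2 <= 2 * (a ^+ 2 + b ^+ 2)]. *)
Lemma subr_sqr_le_sqrt2 (a b d e : C) : 0 <= a -> 0 <= b -> 0 <= d -> 0 <= e ->
  a <= b + d -> b ^+ 2 + a ^+ 2 <= e ^+ 2 ->
  a ^+ 2 - b ^+ 2 <= sqrtC 2 * e * d.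
Proof.
move=> a0 b0 d0 e0 abd abe.
have s0 : 0 <= sqrtC 2 :> C by rewrite sqrtC_ge0.
have ab_le : a + b <= sqrtC 2 * e.
  rewrite -ler_sqr ?nnegrE ?addr_ge0 ?mulr_ge0 // exprMn sqrtCK.
  apply: le_trans (ler_wpM2l _ abe) => //; rewrite -subr_ge0.
  rewrite [X in 0 <= X](_ : _ = (a - b) ^+ 2); last by ring.
  by rewrite -realEsqr rpredB ?ger0_real.
rewrite subr_sqr mulrC; apply: le_trans (ler_wpM2r d0 ab_le).
by rewrite ler_wpM2l ?addr_ge0 // lerBlDl.
Qed.

(** The two triangle inequalities say [`|d - a| <= b]; squaring this gives the
    claim with [2 * a] in place of [c]. *)
Lemma subr_sqr_le_mul (a b c d : C) : 0 <= a -> 0 <= b -> 0 <= d ->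
  a <= b + d -> d <= a + b -> 2 * a <= c ->
  a ^+ 2 - b ^+ 2 <= c * d - d ^+ 2.
Proof.
move=> a0 b0 d0 abd dab ac.
apply: (@le_trans _ _ (2 * a * d - d ^+ 2)); last by rewrite lerD2r ler_wpM2r.
have : (d - a) ^+ 2 <= b ^+ 2.
  have da_real : d - a \is Num.real by rewrite rpredB ?ger0_real.
  rewrite -(real_normK da_real) ler_sqr ?nnegrE //.
  by rewrite real_ler_norml // lerBlDl dab lerBrDr addrC lerBlDl abd.
rewrite -subr_ge0 -[_ <= _ - d ^+ 2]subr_ge0.
by congr (0 <= _); ring.
Qed.

(** * Perturbation bounds *)

Lemma schur_perturbation n (hn : (0 < n)%N)
    (A E : 'M[C]_n) (lam lamt : 'I_n -> C)
    (hA : A \is hermsymmx)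
    (hlam : is_spectrum A lam)
    (hlamt : is_spectrum (A + E) lamt)
    (U : 'M[C]_n) (hU : U \in schur_unitary (A + E)) :
  let Delta := strict_upper (U^t* *m (A + E) *m U) in
  exists pi : 'S_n,
    let D2 := sqrtC (\sum_(i < n) `|lamt (pi i) - lam i| ^+ 2) in
    [/\ D2 <= sqrtC (frob E ^+ 2 + delta E ^+ 2),
        D2 <= sqrtC (frob E ^+ 2 + sqrtC 2 * delta E * frob Delta),
        D2 <= sqrtC (frob E ^+ 2 + 2 * delta E * frob Delta - frob Delta ^+ 2),
        D2 <= sqrtC (frob E ^+ 2 + 2^-1 * delta A ^+ 2) &
        D2 <= sqrtC (frob E ^+ 2 + sqrtC 2 * delta A * frob Delta
                     - frob Delta ^+ 2)].
Proof.
move: hU; rewrite inE => /andP[UU].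
set T := U^t* *m (A + E) *m U => T_upper Delta.
pose H := U^t* *m A *m U; pose F := U^t* *m E *m U; pose S := strict_upper H.
have H_herm : H \is hermsymmx by apply: hermsymmx_conj.
have F_TH : F = T - H by rewrite -mulmxBl -mulmxBr addrC addKr.
have F_upper : strict_upper F = Delta - S.
  by rewrite F_TH strict_upperD strict_upperN.
have F_lower : frob (strict_upper F^T) = frob S.
  rewrite F_TH linearB strict_upperD strict_upperN.
  rewrite (_ : strict_upper T^T = 0) ?sub0r ?frobN ?frob_lower_herm //.
  apply/matrixP=> i j; rewrite mxE [RHS]mxE; case: ifP => //.
  exact: (is_trig_mxP T_upper).
set a := frob S in F_lower; set d := frob Delta; pose b := frob (Delta - S).
have [a0 b0 d0] : [/\ 0 <= a, 0 <= b & 0 <= d] by split; apply: frob_ge0.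
have a_bd : a <= b + d.
  by rewrite /a -[S](subKr Delta) addrC -[b]frobN; apply: ler_frobD.
have d_ab : d <= a + b by rewrite /d -[Delta](subrK S) addrC ler_frobD.
have eE : b ^+ 2 + a ^+ 2 <= delta E ^+ 2.
  rewrite -(delta_conj E UU) -/F; have := offdiag_le_delta F hn.
  by rewrite F_upper F_lower.
have eA : a ^+ 2 + a ^+ 2 <= delta A ^+ 2.
  rewrite -(delta_conj A UU) -/H; have := offdiag_le_delta H hn.
  by rewrite frob_lower_herm.
have [deltaE_ge0 deltaA_ge0] := (delta_ge0 E hn, delta_ge0 A hn).
have H_lam : is_spectrum H lam by rewrite /is_spectrum char_poly_conj.
have T_diag : is_spectrum T (fun i => T i i).
  rewrite /is_spectrum /char_poly -det_tr.
  have := char_poly_trig T_upper; rewrite /char_poly.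
  rewrite (_ : char_poly_mx T^T = (char_poly_mx T)^T) => [->|].
    by apply: eq_bigr => i _; rewrite mxE.
  by rewrite /char_poly_mx linearB /= tr_scalar_mx map_trmx.
have T_lamt : is_spectrum T lamt by rewrite /is_spectrum char_poly_conj.
have [p T_p] := spectrum_perm T_diag T_lamt.
have [s] := hoffman_wielandt (fun i => T i i) H_herm H_lam.
rewrite frob_diag_sub // -F_TH frob_mulmxU // frob_Umulmx // -/S -/Delta -/a -/b.
move=> HW.
(* Each of the five bounds is thereby an estimate of [a ^+ 2 - b ^+ 2]. *)
have {}HW x : a ^+ 2 - b ^+ 2 <= x ->
    sqrtC (\sum_i `|lamt ((s * p)%g i) - lam i| ^+ 2) <= sqrtC (frob E ^+ 2 + x).
  move=> ab_x; have {}HW :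
      \sum_i `|lamt ((s * p)%g i) - lam i| ^+ 2 <= frob E ^+ 2 + x.
    under eq_bigr => i _ do rewrite permM -T_p.
    by apply: le_trans HW _; rewrite -addrA lerD2l.
  have D0 : 0 <= \sum_i `|lamt ((s * p)%g i) - lam i| ^+ 2.
    by rewrite sumr_ge0 // => i _; rewrite exprn_ge0.
  by rewrite ler_sqrtC ?nnegrE // (le_trans D0).
exists (s * p)%g; split; rewrite -?addrA; apply: HW.
- apply: le_trans eE; rewrite lerBlDr -addrA [X in _ <= X]addrC -addrA lerDl.
  by rewrite addr_ge0 ?exprn_ge0.
- exact: subr_sqr_le_sqrt2.
- apply: subr_sqr_le_mul => //; rewrite ler_pM2l ?ltr0n // -ler_sqr ?nnegrE //.
  by apply: le_trans eE; rewrite lerDr exprn_ge0.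
- rewrite lerBlDr; apply: (@le_trans _ _ (2^-1 * delta A ^+ 2)).
    by rewrite ler_pdivlMl ?ltr0n // mulr_natl mulr2n.
  by rewrite lerDl exprn_ge0.
apply: subr_sqr_le_mul => //; rewrite -ler_sqr ?nnegrE ?mulr_ge0 ?(sqrtC_ge0 2) //.
rewrite !exprMn (sqrtCK 2) [2 ^+ 2]expr2 -mulrA ler_pM2l ?ltr0n //.
by rewrite mulr_natl mulr2n.
Qed.

End Matrices.

Theorem theorem4p2 (R : realType) (n : nat) (hn : (0 < n)%N)
    (A E : 'M[R[i]]_n) (lam lamt : 'I_n -> R[i])
    (hA : A \is hermsymmx)
    (hlam : is_spectrum A lam)
    (hlamt : is_spectrum (A + E) lamt)
    (U : 'M[R[i]]_n) (hU : U \in schur_unitary (A + E)) :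
  let Delta := strict_upper (U^t* *m (A + E) *m U) in
  exists pi : 'S_n,
    let D2 := sqrtC (\sum_(i < n) `|lamt (pi i) - lam i| ^+ 2) in
    [/\ D2 <= sqrtC (frob E ^+ 2 + delta E ^+ 2),
        D2 <= sqrtC (frob E ^+ 2 + sqrtC 2 * delta E * frob Delta),
        D2 <= sqrtC (frob E ^+ 2 + 2 * delta E * frob Delta - frob Delta ^+ 2),
        D2 <= sqrtC (frob E ^+ 2 + 2^-1 * delta A ^+ 2) &
        D2 <= sqrtC (frob E ^+ 2 + sqrtC 2 * delta A * frob Delta
                     - frob Delta ^+ 2)].
Proof. exact: schur_perturbation. Qed.
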